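(* Let $A,B,C,\alpha_0,\gamma_0$ be real with $C>0$, let $m\ge1$ be an integer, and let $\beta_0=(m+1)C$. With the notation of the context, the following statements are equivalent: (1) $\alpha_0=A$; (2) $[a_n(x)]_{\ge m}=x^mP_n(x)$ for every $n\ge0$; (3) $a_{n,k+m}=w_{n,k}$ for every $n,k\ge0$. When these conditions hold, $$x^m w(x,t)=[a(x,t)]_{\ge m}\qquad\text{and}\qquad W(t)=[x^m]a(x,t)=\frac1{m!}\,\partial_x^m a(x,t)\Big|_{x=0}.$$ If $\alpha_0\ne A$, the discrepancy is already visible after two steps: $$a_{2,m}-w_{2,0}=mC(\alpha_0-A).$$
   Context: Original model: Motzkin paths start at height $0$, never go below $0$, and have step weights $\alpha_k=Ak+\alpha_0$ for $k\to k+1$, $\gamma_k=Bk+\gamma_0$ for $k\to k$, $\beta_k=Ck+\beta_0=C(k+m+1)$ for $k+1\to k$ ($k\ge0$; down-steps indexed by arrival height). The weight of a path is the product of its step weights (empty path: $1$). $w_{n,k}$ is the total weight of paths of length $n$ ending at height $k$; $P_n(x)=\sum_{k\ge0}w_{n,k}x^k$; $w(x,t)=\sum_{n\ge0}P_n(x)t^n/n!$; $W(t)=w(0,t)$. Auxiliary shifted model on heights $j\ge0$: step weights $\widetilde\alpha_j=Aj+\alpha_0-mA$ for $j\to j+1$, $\widetilde\gamma_j=Bj+\gamma_0-mB$ for $j\to j$, $\widetilde\beta_j=C(j+1)$ for $j+1\to j$ (possibly zero or negative; totals are then signed). $a_{n,j}$ is the total weight of auxiliary paths of length $n$ which start at height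 $m$, remain at heights $\ge0$, and end at height $j$; $a_n(x)=\sum_{j\ge0}a_{n,j}x^j$ and $a(x,t)=\sum_{n\ge0}a_n(x)t^n/n!$. For a polynomial or formal power series $f$ in $x$, $[f(x)]_{\ge m}=f(x)-\sum_{j=0}^{m-1}\big([x^j]f(x)\big)x^j$. *)

(* Defs.v *)
From HB Require Import structures.
From mathcomp Require Import all_boot all_order all_algebra.
From mathcomp Require Import reals.

Set Implicit Arguments.
Unset Strict Implicit.
Unset Printing Implicit Defensive.

Import Order.TTheory GRing.Theory Num.Theory.
Local Open Scope ring_scope.

Inductive step := Up | Level | Down.

Definition step_code (s : step) : option bool :=
  match s with Up => Some true | Level => None | Down => Some false end.

Definition step_decode (c : option bool) : step :=
  match c with Some true => Up | None => Level | Some false => Down end.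

Lemma step_codeK : cancel step_code step_decode.
Proof. by case. Qed.

HB.instance Definition _ := Countable.copy step (can_type step_codeK).
HB.instance Definition _ : isFinite step := CanIsFinite step_codeK.

(* [None] when the path started at height [h] goes below height 0. *)
Fixpoint path_end (h : nat) (p : seq step) : option nat :=
  match p with
  | [::] => Some h
  | Up :: q => path_end h.+1 q
  | Level :: q => path_end h q
  | Down :: q => if h is h'.+1 then path_end h' q else None
  end.

Section Paths.
Variable R : pzRingType.
Variables al ga be : nat -> R.

(* A down-step is weighted by its arrival height.  The value 0 given to paths
   that go below height 0 is never used: [total_weight] excludes them. *)
Fixpoint path_weight (h : nat) (p : seq step) : R :=
  match p with
  | [::] => 1
  | Up :: q => al h * path_weight h.+1 q
  | Level :: q => ga h * path_weight h q
  | Down :: q => if h is h'.+1 then be h' * path_weight h' q else 0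
  end.

Definition total_weight (h n k : nat) : R :=
  \sum_(p : n.-tuple step | path_end h p == Some k) path_weight h p.

End Paths.

Section Series.
Variable R : realType.

(* Formal power series in [t] over the polynomials in [x], and over the
   constants; the n-th value is the coefficient of t^n. *)
Definition xtseries := nat -> {poly R}.
Definition tseries := nat -> R.

Definition egf (u : nat -> {poly R}) : xtseries := fun n => (n`!)%:R^-1 *: u n.

Definition mulx (m : nat) (F : xtseries) : xtseries := fun n => 'X^m * F n.
Definition eval_x (c : R) (F : xtseries) : tseries := fun n => (F n).[c].
Definition coef_x (j : nat) (F : xtseries) : tseries := fun n => (F n)`_j.
Definition deriv_x (m : nat) (F : xtseries) : xtseries := fun n => (F n)^`(m).
Definition scale_t (c : R) (f : tseries) : tseries := fun n => c * f n.

Definition ge_part (m : nat) (f : {poly R}) : {poly R} :=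
  f - \sum_(j < m) f`_j *: 'X^j.

Definition ge_part_xt (m : nat) (F : xtseries) : xtseries :=
  fun n => F n - \sum_(j < m) coef_x j F n *: 'X^j.

End Series.

Section Models.
Variable R : realType.
Variables A B C alpha0 gamma0 : R.

Definition w_coef (beta0 : R) (n k : nat) : R :=
  total_weight (fun k => A * k%:R + alpha0) (fun k => B * k%:R + gamma0)
    (fun k => C * k%:R + beta0) 0 n k.

(* The sum over all heights is cut at n, the largest height reachable in n
   steps; see [coef_P_poly]. *)
Definition P_poly (beta0 : R) (n : nat) : {poly R} :=
  \poly_(k < n.+1) w_coef beta0 n k.

Definition w_series (beta0 : R) : xtseries R := egf (P_poly beta0).

Definition W_series (beta0 : R) : tseries R := eval_x 0 (w_series beta0).

Definition a_coef (m n j : nat) : R :=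
  total_weight (fun j => A * j%:R + alpha0 - m%:R * A)
    (fun j => B * j%:R + gamma0 - m%:R * B)
    (fun j => C * (j%:R + 1)) m n j.

(* Cut at the largest reachable height m + n; see [coef_a_poly]. *)
Definition a_poly (m n : nat) : {poly R} := \poly_(j < (m + n).+1) a_coef m n j.

Definition a_series (m : nat) : xtseries R := egf (a_poly m).

End Models.

Lemma path_end_le (h k : nat) (p : seq step) :
  path_end h p = Some k -> (k <= h + size p)%N.
Proof.
elim: p h => [|s p IH] h /=; first by case=> <-; rewrite addn0.
case: s => [/IH|/IH|]; first by rewrite addSnnS.
  by move=> le_k; rewrite addnS ltnW.
by case: h => // h /IH le_k; rewrite addSn addnS; apply: leqW (leqW le_k).
Qed.

Lemma total_weight_eq0 (R : pzRingType) (al ga be : nat -> R) (h n k : nat) :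
  (h + n < k)%N -> total_weight al ga be h n k = 0.
Proof.
move=> lt_k; rewrite /total_weight big_pred0 // => p; apply/eqP => /path_end_le.
by rewrite size_tuple leqNgt lt_k.
Qed.

Lemma coef_P_poly (R : realType) (A B C alpha0 gamma0 beta0 : R) (n k : nat) :
  (P_poly A B C alpha0 gamma0 beta0 n)`_k =
  w_coef A B C alpha0 gamma0 beta0 n k.
Proof.
rewrite coef_poly; case: ltnP => // lt_k.
by rewrite /w_coef total_weight_eq0.
Qed.

Lemma coef_a_poly (R : realType) (A B C alpha0 gamma0 : R) (m n j : nat) :
  (a_poly A B C alpha0 gamma0 m n)`_j = a_coef A B C alpha0 gamma0 m n j.
Proof.
rewrite coef_poly; case: ltnP => // lt_j.
by rewrite /a_coef total_weight_eq0.
Qed.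

(* Main.v *)
Require Import Defs.
From mathcomp Require Import all_boot all_order all_algebra.
From mathcomp Require Import reals.
From mathcomp Require Import boolp ring.

Import Order.TTheory GRing.Theory Num.Theory.
Local Open Scope ring_scope.

(** Moving the original model up by [m] turns its step weights into those of
    the auxiliary model at heights at least [m]; for the down-steps this is
    what the choice [beta0 = (m + 1) C] achieves.  The two models therefore
    differ only in that an auxiliary path may go below height [m], and such a
    path can end at height [m] or more only by climbing back through the
    up-step from [m - 1] to [m], whose weight is
    [A (m - 1) + alpha0 - m A = alpha0 - A].

    If [alpha0 = A], that bridge has weight 0, so the excursions below [m]
    contribute nothing and [a_(n,k+m) = w_(n,k)]
    ([total_weight_shift]).  Conversely, among the two-step paths from [m]
    back to [m], only Down-Up leaves the region common to both models, so
    [a_(2,m) - w_(2,0)] is its weight [m C (alpha0 - A)], which vanishes only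
    if [alpha0 = A] because [m C <> 0].  The remaining statements restate the
    equality of coefficients for polynomials and generating functions
    ([ge_part_eqP]). *)

Section TotalWeight.
Variables (R : pzRingType) (al ga be : nat -> R).

Lemma big_step (F : step -> R) :
  \sum_(s : step) F s = F Up + F Level + F Down.
Proof.
rewrite (bigD1 Up) // (bigD1 Level) //= (bigD1 Down) //= big1 ?addr0 ?addrA //.
by case.
Qed.

Lemma total_weight0 (h k : nat) :
  total_weight al ga be h 0 k = (h == k)%:R.
Proof.
rewrite /total_weight big_mkcond (bigD1 [tuple]) //= big1 ?addr0.
  by rewrite (inj_eq Some_inj); case: eqP.
by move=> p /eqP[]; exact: tuple0.
Qed.

(** Splitting off the first step, rather than the last, keeps the end height
    fixed and so suits inductions over all starting heights. *)
Lemma total_weightS (h n k : nat) :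
  total_weight al ga be h n.+1 k =
    al h * total_weight al ga be h.+1 n k + ga h * total_weight al ga be h n k
    + (if h is h'.+1 then be h' * total_weight al ga be h' n k else 0).
Proof.
transitivity (\sum_(s : step) \sum_(p : n.-tuple step)
   if path_end h (s :: p) == Some k then path_weight al ga be h (s :: p)
   else 0).
  rewrite /total_weight big_mkcond pair_big /=.
  rewrite (reindex (fun sp : step * n.-tuple step => cons_tuple sp.1 sp.2)) //=.
  exists (fun t => (thead t, behead_tuple t)) => [[s p] _|t _] /=.
    by congr (_, _); apply: val_inj.
  by rewrite [RHS]tuple_eta; apply: val_inj.
rewrite big_step /total_weight; congr (_ + _ + _).
- by rewrite -big_mkcond mulr_sumr.
- by rewrite -big_mkcond mulr_sumr.
case: h => [|h] /=; first by rewrite big1.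
by rewrite -big_mkcond mulr_sumr.
Qed.

(** Heights change by at most one per step, so a path from [m] or below to a
    height above [m] must use the up-step from [m]. *)
Lemma total_weight_barrier (m h n k : nat) :
  al m = 0 -> (h <= m)%N -> (m < k)%N -> total_weight al ga be h n k = 0.
Proof.
move=> al_m0 + lt_mk; elim: n h => [|n IH] h le_hm.
  by rewrite total_weight0 ltn_eqF // (leq_ltn_trans le_hm).
rewrite total_weightS (IH h) // mulr0 addr0.
have -> : al h * total_weight al ga be h.+1 n k = 0.
  by case: ltngtP le_hm => // [/IH->|->] _; rewrite ?mulr0 // al_m0 mul0r.
by case: h le_hm => [|h] lt_hm; rewrite ?add0r // IH ?mulr0 // ltnW.
Qed.

Lemma total_weight1 (h k : nat) :
  total_weight al ga be h 1 k =
    al h * (h.+1 == k)%:R + ga h * (h == k)%:R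
    + (if h is h'.+1 then be h' * (h' == k)%:R else 0).
Proof.
rewrite total_weightS !total_weight0.
by case: h => // h; rewrite total_weight0.
Qed.

Lemma total_weight2_bottom :
  total_weight al ga be 0 2 0 = al 0 * be 0 + ga 0 * ga 0.
Proof.
by rewrite total_weightS !total_weight1 /= !(mulr0, mulr1, add0r, addr0).
Qed.

(** The last term, which [total_weight2_bottom] lacks, is the Down-Up path. *)
Lemma total_weight2_loop (h : nat) :
  total_weight al ga be h.+1 2 h.+1 =
    al h.+1 * be h.+1 + ga h.+1 * ga h.+1 + be h * al h.
Proof.
have up_neq j : (j.+1 == j) = false by rewrite gtn_eqF.
have down_neq j : (j == j.+1) = false by rewrite ltn_eqF.
have upup_neq j : (j.+2 == j) = false by rewrite gtn_eqF.
have downdown_neq j : (j == j.+2) = false by rewrite ltn_eqF.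
rewrite total_weightS !total_weight1 !eqxx up_neq down_neq upup_neq.
by case: h => [|h]; rewrite ?downdown_neq !(mulr0, mulr1, add0r, addr0).
Qed.

End TotalWeight.

(** Two models whose weights agree up to a vertical shift by [m + 1] have the
    same path totals as soon as the up-step from [m] to [m + 1] has weight 0:
    then a path that dips below the shifted ground level is lost. *)
Lemma total_weight_shift (R : pzRingType) (al ga be al' ga' be' : nat -> R)
    (m : nat) :
  al m = 0 ->
  (forall k, al (k + m.+1)%N = al' k) ->
  (forall k, ga (k + m.+1)%N = ga' k) ->
  (forall k, be (k + m.+1)%N = be' k) ->
  forall h n k, total_weight al ga be (h + m.+1) n (k + m.+1) =
    total_weight al' ga' be' h n k.
Proof.
move=> al_m0 alE gaE beE h n k; elim: n h => [|n IH] h.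
  by rewrite !total_weight0 eqn_add2r.
rewrite !total_weightS alE gaE -addSn !IH; congr (_ + _).
case: h => [|h]; last by rewrite /= beE IH.
rewrite add0n (@total_weight_barrier _ _ _ _ m) ?mulr0 //.
by rewrite addnS ltnS leq_addl.
Qed.

Lemma coef_ge_part (R : realType) (m : nat) (f : {poly R}) (i : nat) :
  (ge_part m f)`_i = if (i < m)%N then 0 else f`_i.
Proof.
rewrite /ge_part coefB -poly_def coef_poly.
by case: ifP => _; rewrite ?subrr ?subr0.
Qed.

(** Both sides have no terms below degree [m], so equality can be tested on
    the coefficients from [m] onwards. *)
Lemma ge_part_eqP (R : realType) (m : nat) (f g : {poly R}) :
  ge_part m f = 'X^m * g <-> forall k, f`_(k + m) = g`_k.
Proof.
split=> [fgE k|fgE].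
  have := congr1 (fun p : {poly R} => p`_(k + m)) fgE.
  by rewrite coef_ge_part coefXnM !ltnNge leq_addl /= addnK.
apply/polyP => i; rewrite coef_ge_part coefXnM; case: ltnP => // le_mi.
by rewrite -fgE subnK.
Qed.

Theorem proposition3p4 (R : realType) (A B C alpha0 gamma0 beta0 : R) (m : nat)
    (C_gt0 : 0 < C) (m_ge1 : (1 <= m)%N) (beta0E : beta0 = (m%:R + 1) * C) :
  let w := w_coef A B C alpha0 gamma0 beta0 in
  let P := P_poly A B C alpha0 gamma0 beta0 in
  let wxt := w_series A B C alpha0 gamma0 beta0 in
  let W := W_series A B C alpha0 gamma0 beta0 in
  let a := a_coef A B C alpha0 gamma0 m in
  let ax := a_poly A B C alpha0 gamma0 m in
  let axt := a_series A B C alpha0 gamma0 m in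
  [/\ [<-> alpha0 = A;
           forall n : nat, ge_part m (ax n) = 'X^m * P n;
           forall n k : nat, a n (k + m)%N = w n k],
      alpha0 = A ->
        [/\ mulx m wxt = ge_part_xt m axt,
            W = coef_x m axt &
            coef_x m axt = scale_t (m`!)%:R^-1 (eval_x 0 (deriv_x m axt))]
    & alpha0 <> A ->
        a 2%N m <> w 2%N 0%N /\
        a 2%N m - w 2%N 0%N = m%:R * C * (alpha0 - A)].
Proof.
(* From here on [m.+1] stands for the [m] of the statement. *)
case: m m_ge1 beta0E => // m _ beta0E w P wxt W a ax axt.
have mC_neq0 : m.+1%:R * C != 0 by rewrite mulf_neq0 ?pnatr_eq0 // gt_eqF.
have discrepancy : a 2%N m.+1 - w 2%N 0%N = m.+1%:R * C * (alpha0 - A).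
  rewrite /a /w /a_coef /w_coef beta0E total_weight2_bottom total_weight2_loop.
  by rewrite -[m.+1]addn1 natrD; ring.
have alpha0_eq : a 2%N m.+1 = w 2%N 0%N -> alpha0 = A.
  move=> awE; apply/eqP; move/eqP: discrepancy.
  by rewrite awE subrr eq_sym mulf_eq0 (negPf mC_neq0) subr_eq0.
have bridge : alpha0 = A -> forall n k, a n (k + m.+1)%N = w n k.
  move=> alphaE n k; rewrite /a /w /a_coef /w_coef.
  (* The original model starts at height 0, moved up to [0 + m.+1]. *)
  by apply: (total_weight_shift _ _ _ _ _ _ _ m _ _ _ _ 0) => [|j|j|j];
    rewrite ?beta0E ?alphaE -?[m.+1]addn1 ?natrD; ring.
have polyE n : ge_part m.+1 (ax n) = 'X^(m.+1) * P n <->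
    forall k, a n (k + m.+1)%N = w n k.
  rewrite ge_part_eqP /ax /P.
  by split=> E k; have := E k; rewrite coef_a_poly coef_P_poly.
split.
- tfae.
  + by move=> alphaE n; apply/polyE/bridge.
  + by move=> E n; apply/polyE.
  + by move=> /(_ 2%N 0%N); rewrite add0n.
- move=> /bridge awE.
  have coefE n k : (axt n)`_(k + m.+1) = (wxt n)`_k.
    by rewrite !coefZ coef_a_poly coef_P_poly [a_coef _ _ _ _ _ _ _ _]awE.
  split; apply/funext => n.
  + by apply/esym/ge_part_eqP.
  + by rewrite /W /W_series /eval_x horner_coef0 -coefE.
  + rewrite /scale_t /eval_x /deriv_x horner_coef0 coef_derivn addn0 ffactnn.
    by rewrite -[X in _ * X]mulr_natl mulKf // pnatr_eq0 -lt0n fact_gt0.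
- by move=> alphaN; split=> // /alpha0_eq.
Qed.
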